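(* Let $k\ge1$ and $1\le h\le k$ be integers with $h$ dividing $k$, let $c\ge0$, and let $X_1,\dots,X_k$ be mutually independent candidates with $f_h(X_i)\le c$ for all $i$. Then $$g_h(X_1,\dots,X_k)\le 2hc+\frac{hc}{1-e^{-1/2}}.$$
   Context: A candidate is a nonnegative discrete random variable taking finitely many values. $g_h(X_1,\dots,X_k)$ is the expected sum of the $h$ largest values among $X_1,\dots,X_k$. $f_h(X)=\mathbb{E}\big(\max(X^{[1]},\dots,X^{[k/h]})\big)$ where $X^{[1]},\dots,X^{[k/h]}$ are independent copies of $X$. *)

(* Defs.v *)
From HB Require Import structures.
From mathcomp Require Import all_boot all_order all_algebra.
From mathcomp Require Import all_classical all_reals all_analysis.

Set Implicit Arguments.
Unset Strict Implicit.
Unset Printing Implicit Defensive.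

Import Order.TTheory GRing.Theory Num.Theory.
Import numFieldNormedType.Exports.

Local Open Scope classical_set_scope.
Local Open Scope ring_scope.

Definition candidate (d : measure_display) (T : measurableType d)
    (R : realType) (P : probability T R) (X : {RV P >-> R}) : Prop :=
  (forall w, 0 <= X w) /\ finite_set (range X).

Definition mutually_independent (d : measure_display) (T : measurableType d)
    (R : realType) (P : probability T R) (I : finType)
    (X : I -> {RV P >-> R}) : Prop :=
  forall (J : {set I}) (A : I -> set R), (forall i, measurable (A i)) ->
    P (\bigcap_(i in [set` J]) (X i @^-1` A i)) =
    (\prod_(i in J) P (X i @^-1` A i))%E.

Section power_probability.
Context (d : measure_display) (T : measurableType d) (R : realType).
Variable P : probability T R.

Definition cons_pair n (x : T * n.-tuple T) : n.+1.-tuple T :=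
  [the n.+1.-tuple T of x.1 :: x.2].

Lemma measurable_cons_pair n : measurable_fun [set: _] (@cons_pair n).
Proof. exact: measurable_cons. Qed.

HB.instance Definition _ n :=
  isMeasurableFun.Build _ _ _ _ (@cons_pair n) (@measurable_cons_pair n).

(* The product probability P \x ... \x P (n factors) on T^n. *)
Fixpoint power_probability n : probability (n.-tuple T) R :=
  match n with
  | 0 => \d_[tuple]
  | m.+1 => distribution (P \x power_probability m)%E (@cons_pair m)
  end.

Section copy.
Variables (X : {RV P >-> R}) (n : nat) (j : 'I_n).

Definition copy_fun (w : n.-tuple T) : R := X (tnth w j).

Lemma measurable_copy_fun : measurable_fun [set: _] copy_fun.
Proof. exact: measurableT_comp (measurable_tnth j). Qed.

HB.instance Definition _ :=
  isMeasurableFun.Build _ _ _ _ copy_fun measurable_copy_fun.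

(* The j-th of n independent copies of X, all living on T^n: see
   distribution_copy and independent_copy below. *)
Definition copy : {RV (power_probability n) >-> R} := copy_fun.

End copy.

Lemma power_probability_box n (A : 'I_n -> set T) :
  (forall i, measurable (A i)) ->
  power_probability n [set w | forall i, A i (tnth w i)] =
  (\prod_(i < n) P (A i))%E.
Proof.
elim: n A => [|n IH] A mA.
  by rewrite big_ord0 /= diracE mem_set// => -[].
have mB m (B : 'I_m -> set T) : (forall i, measurable (B i)) ->
    measurable [set w : m.-tuple T | forall i, B i (tnth w i)].
  move=> mB.
  rewrite (_ : mkset _ =
    \bigcap_(i in [set: 'I_m]) ((fun w => tnth w i) @^-1` B i)).
    apply: fin_bigcap_measurable => [|i _]; first exact: finite_finset.
    by rewrite -[X in measurable X]setTI;
      exact: (measurable_tnth i measurableT (mB i)).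
  by apply/seteqP; split => [w h i _|w h i]; exact: h.
rewrite big_ord_recl -IH; last by [].
transitivity ((P \x power_probability n)%E (A ord0 `*`
    [set w | forall i, A (lift ord0 i) (tnth w i)])); last first.
  have mA1 := mB _ _ (fun i => mA (lift ord0 i)).
  exact: product_measure1E.
rewrite /= /distribution /pushforward; congr (product_measure1 _ _ _).
apply/seteqP; split => [[x w]|[x w]] /=.
  move=> h; split; first exact: (h ord0).
  by move=> i; have := h (lift ord0 i); rewrite /= tnthS.
move=> [h0 h] i; case: (unliftP ord0 i) => [k ->|-> //].
by rewrite tnthS; exact: h.
Qed.

Lemma distribution_copy (X : {RV P >-> R}) n (j : 'I_n) (A : set R) :
  measurable A ->
  distribution (power_probability n) (copy X j) A = distribution P X A.
Proof.
move=> mA; have mXA : measurable (X @^-1` A) by exact: measurable_funPTI.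
transitivity (power_probability n [set w | forall i,
    (if i == j then X @^-1` A else setT) (tnth w i)]).
  congr (power_probability n _); apply/seteqP; split => w /=.
    by move=> h i; case: eqP => [->|].
  by move=> /(_ j); rewrite eqxx.
rewrite (power_probability_box (A := fun i => if i == j then _ else _)).
  rewrite (bigD1 j)//= eqxx big1 ?mule1// => i /negPf ->.
  exact: probability_setT.
by move=> i; case: eqP.
Qed.

Lemma independent_copy (X : {RV P >-> R}) n :
  mutually_independent (fun j : 'I_n => copy X j).
Proof.
move=> J A mA.
have mXA i : measurable (X @^-1` A i) by exact: measurable_funPTI.
transitivity (power_probability n [set w | forall i,
    (if i \in J then X @^-1` A i else setT) (tnth w i)]).
  congr (power_probability n _); apply/seteqP; split => w /=.
    by move=> h i; case: ifPn => // /h.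
  by move=> h i /= iJ; have := h i; rewrite iJ.
rewrite (power_probability_box (A := fun i => if i \in J then _ else _)).
  rewrite [RHS]big_mkcond/=; apply: eq_bigr => i _; case: ifPn => _.
    by rewrite -[LHS](distribution_copy X i).
  exact: probability_setT.
by move=> i; case: ifP.
Qed.

End power_probability.

Section objectives.
Context (d : measure_display) (T : measurableType d) (R : realType).
Variable P : probability T R.
Local Open Scope ereal_scope.

Definition sum_largest (h : nat) (s : seq R) : R :=
  (\sum_(v <- take h (sort (fun x y => y <= x) s)) v)%R.

Definition g_top (h k : nat) (X : 'I_k -> {RV P >-> R}) : \bar R :=
  'E_P[fun w => sum_largest h [seq X i w | i <- enum 'I_k]].

(* The default value 0 of the maximum is harmless: X is nonnegative and
   k %/ h > 0 for candidates. *)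
Definition f_top (h k : nat) (X : {RV P >-> R}) : \bar R :=
  'E_(power_probability P (k %/ h))[
    fun w => \big[Num.max/0%R]_(j < k %/ h) copy X j w].

End objectives.

(* Main.v *)
(** Let [n = k / h], [t = 2c] and [e(x) = (x - t)^+].  Pointwise, the sum of the
    [h] largest values is at most [h t + \sum_i e(X_i)].  If [M_n] is the maximum
    of [n] independent copies of [X] and [q = P(X <= t)], then keeping only the
    event that at most one copy exceeds [t] gives
    [n q^n E e(X) <= E e(M_n) <= E M_n <= c], while Markov's inequality gives
    [q^n = P(M_n <= t) >= 1/2].  Hence [E e(X_i) <= 2c/n], and summing over the
    [k = h n] candidates yields [g_h <= 4 h c]; finally [e^(-1/2) >= 1/2].  Markov
    needs [c > 0]; the case [c = 0] follows by letting [c] decrease to [0]. *)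

Require Import Defs.
From mathcomp Require Import all_boot all_order all_algebra.
From mathcomp Require Import all_classical all_reals all_analysis.
From mathcomp Require Import measurable_realfun.
From mathcomp Require Import lra ring.

Import Order.TTheory GRing.Theory Num.Theory.
Import numFieldNormedType.Exports.

Local Open Scope classical_set_scope.
Local Open Scope ring_scope.

(** * Excess over a threshold, and sums of largest values *)

Definition excess {R : realType} (t x : R) : R := Num.max (x - t) 0.

Lemma excess_ge0 (R : realType) (t x : R) : 0 <= excess t x.
Proof. by rewrite /excess le_max lexx orbT. Qed.

Lemma le_excess (R : realType) (t x : R) : x <= t + excess t x.
Proof. by rewrite -lerBlDl /excess le_max lexx. Qed.

Lemma excess_le (R : realType) (t x : R) :
  0 <= t -> 0 <= x -> excess t x <= x.
Proof. by move=> t0 x0; rewrite /excess ge_max x0 andbT lerBlDr lerDl. Qed.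

(** Each value kept is at most [t] plus its own excess, and the excesses of the dropped values are
    nonnegative. If [s] has fewer than [h] entries, [0 <= t] absorbs the missing terms. *)
Lemma sum_largest_le (R : realType) (h : nat) (s : seq R) (t : R) :
  0 <= t -> sum_largest h s <= h%:R * t + \sum_(v <- s) excess t v.
Proof.
move=> t0; rewrite /sum_largest; set s' := sort _ s.
have -> : \sum_(v <- s) excess t v = \sum_(v <- s') excess t v.
  by apply: perm_big; rewrite perm_sym; apply/permPl/perm_sort.
rewrite -[in leRHS](cat_take_drop h s') big_cat /= addrA.
apply: ler_wpDr; first by apply: sumr_ge0 => v _; exact: excess_ge0.
apply: (@le_trans _ _ (\sum_(v <- take h s') (t + excess t v))).
  by apply: ler_sum => v _; exact: le_excess.
rewrite big_split /= lerD2r big_const_seq count_predT iter_addr_0 -[t *+ _]mulr_natl.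
by rewrite ler_wpM2r// ler_nat size_take_min geq_minl.
Qed.

Lemma sum_largest_ge0 (R : realType) (h : nat) (s : seq R) :
  (forall v, v \in s -> 0 <= v) -> 0 <= sum_largest h s.
Proof.
move=> s0; rewrite /sum_largest big_seq; apply: sumr_ge0 => v /mem_take.
by rewrite mem_sort; exact: s0.
Qed.

(* Unlike [ge0_le_integral], no measurability is needed: the integral of a
   nonnegative function is a supremum over the simple functions below it. *)
Lemma ge0_le_integral_nomeas (d : measure_display) (T : measurableType d)
    (R : realType) (mu : {measure set T -> \bar R}) (f g : T -> \bar R) :
  (forall x, 0 <= f x)%E -> (forall x, f x <= g x)%E ->
  (\int[mu]_x f x <= \int[mu]_x g x)%E.
Proof.
move=> f0 fg; have g0 x : (0 <= g x)%E by exact: le_trans (f0 x) (fg x).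
rewrite !ge0_integralE// !patch_setT.
by apply: ereal_sup_le => _ [u /= uf <-]; exists u => // x; exact: le_trans (fg x).
Qed.

Lemma measurable_bigmaxr (d : measure_display) (T : measurableType d)
    (R : realType) (I : Type) (s : seq I) (F : I -> T -> R) :
  (forall i, measurable_fun setT (F i)) ->
  measurable_fun setT (fun w => \big[Num.max/0]_(i <- s) F i w).
Proof.
move=> mF; elim: s => [|i s IH].
  by under eq_fun do rewrite big_nil; exact: measurable_cst.
by under eq_fun do rewrite big_cons; exact: measurable_maxr.
Qed.

Lemma measurable_excess (d : measure_display) (T : measurableType d)
    (R : realType) (t : R) (f : T -> R) :
  measurable_fun setT f -> measurable_fun setT (fun x => excess t (f x)).
Proof.
move=> mf; apply: measurable_maxr; last exact: measurable_cst.
by apply: measurable_funB => //; exact: measurable_cst.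
Qed.

(** The left side counts an excess only when the other value stays below [t], so it vanishes when
    both exceed [t]. Each term is a function of [x] times a function of [y], so it factors under a
    product measure. *)
Lemma excess_max (R : realType) (t x y : R) :
  excess t x * (y <= t)%R%:R + (x <= t)%R%:R * excess t y <=
  excess t (Num.max x y).
Proof.
have e0 z : z <= t -> excess t z = 0.
  by move=> zt; apply/max_idPr; rewrite subr_le0.
have [xt|xt] := leP x t; have [yt|yt] := leP y t.
- by rewrite (e0 x xt) (e0 y yt) mul0r mulr0 addr0 excess_ge0.
- by rewrite mulr0 add0r mul1r (max_idPr _)// (le_trans xt)// ltW.
- by rewrite mulr1 mul0r addr0 (max_idPl _)// (le_trans yt)// ltW.
- by rewrite mulr0 mul0r addr0 excess_ge0.
Qed.

(** * The maximum of [n] independent copies *)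

Section power_max.
Context (d : measure_display) (T : measurableType d) (R : realType).
Variables (P : probability T R) (X : {RV P >-> R}).

Local Notation Pn := (power_probability P).

Definition max_copy n (w : n.-tuple T) : R :=
  \big[Num.max/0]_(j < n) X (tnth w j).

Lemma max_copy_ge0 n (w : n.-tuple T) : 0 <= max_copy n w.
Proof. exact: bigmax_ge_id. Qed.

Lemma max_copy_cons n (x : T) (w : n.-tuple T) :
  max_copy n.+1 (cons_pair (x, w)) = Num.max (X x) (max_copy n w).
Proof.
rewrite /max_copy big_ord_recl /=; congr Num.max.
by apply: eq_bigr => i _; rewrite tnthS.
Qed.

Lemma measurable_max_copy n : measurable_fun setT (max_copy n).
Proof.
apply: measurable_bigmaxr => i.
by apply: measurableT_comp => //; exact: measurable_tnth.
Qed.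

(** Tonelli, separating the first copy from the other [n]; this drives the induction on the number
    of copies. *)
Lemma power_probability_integralS n (f : n.+1.-tuple T -> \bar R) :
  measurable_fun setT f -> (forall w, 0 <= f w)%E ->
  (\int[Pn n.+1]_w f w = \int[P]_x \int[Pn n]_w f (cons_pair (x, w)))%E.
Proof.
move=> mf f0.
rewrite /= /distribution (@ge0_integral_pushforward _ _ _ _ _ (@cons_pair _ T n))//.
rewrite preimage_setT fubini_tonelli1//.
- by apply: measurableT_comp => //; exact: measurable_cons_pair.
- by move=> w; exact: f0.
Qed.

Lemma power_probability_max_le n (t : R) : 0 <= t ->
  Pn n [set w | max_copy n w <= t] =
  ((fine (P [set x | X x <= t])) ^+ n)%:E.
Proof.
move=> t0.
have mX : measurable [set x | X x <= t].
  rewrite -[X in measurable X]setTI.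
  by apply: measurable_fun_le => //; exact: measurable_cst.
transitivity (Pn n [set w | forall i, [set x | X x <= t] (tnth w i)]).
  congr (Pn n _); apply/seteqP; split => w /=.
    by move=> /bigmax_leP[_ h] i; exact: h.
  by move=> h; apply/bigmax_leP; split.
rewrite (@power_probability_box _ _ _ P n (fun=> _))//.
rewrite -[X in (\prod_(i < n) X)%E]fineK ?fin_num_measure//.
by rewrite prodEFin prodr_const card_ord.
Qed.

Lemma measurable_max_copy_le n (t : R) :
  measurable [set w | max_copy n w <= t].
Proof.
rewrite -[X in measurable X]setTI; apply: measurable_fun_le => //.
exact: measurable_max_copy.
Qed.

Lemma measurable_RV_le (t : R) : measurable [set x | X x <= t].
Proof. by rewrite -[X in measurable X]setTI; exact: measurable_fun_le. Qed.

Lemma integral_max_copy_le n (t : R) : 0 <= t ->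
  (\int[Pn n]_w (\1_[set w | max_copy n w <= t] w)%:E =
  ((fine (P [set x | X x <= t])) ^+ n)%:E)%E.
Proof.
move=> t0; rewrite integral_indic ?setIT//; last exact: measurable_max_copy_le.
exact: power_probability_max_le.
Qed.

(** This is [excess_max] integrated with [x] the first copy and [y] the maximum of the others: their
    events of staying below [t] have probabilities [q] and [q ^+ n]. *)
Lemma integral_excess_max_copyS n (t : R) (q := fine (P [set x | X x <= t])) :
  0 <= t ->
  ((q ^+ n)%:E * \int[P]_x (excess t (X x))%:E
    + \int[Pn n]_w (excess t (max_copy n w))%:E * q%:E <=
   \int[Pn n.+1]_w (excess t (max_copy n.+1 w))%:E)%E.
Proof.
move=> t0; set A := [set x | X x <= t]; set B := [set w | max_copy n w <= t].
have mA : measurable A by exact: measurable_RV_le.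
have mB : measurable B by exact: measurable_max_copy_le.
have mXe : measurable_fun setT (fun x => (excess t (X x))%:E).
  by apply/measurable_EFinP; exact: measurable_excess.
have mMe m : measurable_fun setT (fun w => (excess t (max_copy m w))%:E).
  by apply/measurable_EFinP/measurable_excess; exact: measurable_max_copy.
have e0 x : (0 <= (excess t x)%:E)%E by rewrite lee_fin excess_ge0.
have q0 : 0 <= q by exact: fine_ge0.
set phi := (\int[Pn n]_w _)%E.
have phi0 : (0 <= phi)%E by exact: integral_ge0.
have m1A : measurable_fun setT (fun x => (\1_A x)%:E : \bar R).
  exact/measurable_EFinP/measurable_indic.
have m1B : measurable_fun setT (fun w => (\1_B w)%:E : \bar R).
  exact/measurable_EFinP/measurable_indic.
rewrite power_probability_integralS//.
(* Writing the left side as one integral over the first copy reduces the claim to a comparison for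
   each fixed [x]. *)
have -> : ((q ^+ n)%:E * \int[P]_x (excess t (X x))%:E + phi * q%:E =
   \int[P]_x ((q ^+ n)%:E * (excess t (X x))%:E + phi * (\1_A x)%:E))%E.
  rewrite ge0_integralD//.
  - rewrite ge0_integralZl_EFin ?exprn_ge0// ge0_integralZl//.
    by rewrite integral_indic// setIT fineK ?fin_num_measure.
  - by move=> x _; rewrite mule_ge0// lee_fin exprn_ge0.
  - exact: measurable_funeM.
  - by move=> x _; rewrite mule_ge0.
  - exact: measurable_funeM.
apply: ge0_le_integral_nomeas => x.
  by rewrite adde_ge0// mule_ge0// lee_fin exprn_ge0.
(* For fixed [x], both [q ^+ n] and [phi] are integrals over the remaining [n] copies, so
   [excess_max] applies pointwise in [w]. *)
have -> : ((q ^+ n)%:E * (excess t (X x))%:E + phi * (\1_A x)%:E =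
   \int[Pn n]_w ((excess t (X x))%:E * (\1_B w)%:E
     + (\1_A x)%:E * (excess t (max_copy n w))%:E))%E.
  rewrite ge0_integralD//.
  - rewrite !ge0_integralZl_EFin ?excess_ge0//; last exact: mMe.
    by rewrite integral_max_copy_le// muleC [(phi * _)%E]muleC.
  - by move=> w _; rewrite mule_ge0.
  - exact: measurable_funeM.
  - by move=> w _; rewrite mule_ge0.
  - by apply: measurable_funeM; exact: mMe.
apply: ge0_le_integral_nomeas => w.
  by rewrite adde_ge0// mule_ge0.
rewrite max_copy_cons -!EFinM -EFinD lee_fin.
have := excess_max R t (X x) (max_copy n w).
have -> : (X x <= t) = (x \in A) by apply/idP/idP => [/mem_set|/set_mem].
have -> : (max_copy n w <= t) = (w \in B).
  by apply/idP/idP => [/mem_set|/set_mem].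
by rewrite !indicE.
Qed.

(** Induction on [n]: the old bound gets multiplied by [q], and the new term [q ^+ n] is weakened to
    [q ^+ n.+1] using [q <= 1]. The exponent [n], rather than the sharper [n - 1], matches the power
    bounded in [max_copy_median]. *)
Lemma integral_excess_max_copy n (t : R) (q := fine (P [set x | X x <= t])) :
  0 <= t ->
  ((n%:R * q ^+ n)%:E * \int[P]_x (excess t (X x))%:E <=
   \int[Pn n]_w (excess t (max_copy n w))%:E)%E.
Proof.
move=> t0; set F := (\int[P]_x _)%E.
have F0 : (0 <= F)%E.
  by apply: integral_ge0 => x _; rewrite lee_fin excess_ge0.
have q0 : 0 <= q by exact: fine_ge0.
have q1 : q <= 1.
  rewrite -lee_fin fineK ?fin_num_measure ?probability_le1//;
  exact: measurable_RV_le.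
elim: n => [|n IH].
  rewrite mul0r mul0e; apply: integral_ge0 => w _.
  by rewrite lee_fin excess_ge0.
apply: le_trans (integral_excess_max_copyS n t t0).
rewrite -natr1 mulrDl mul1r addrC EFinD.
rewrite ge0_muleDl ?lee_fin ?mulr_ge0 ?exprn_ge0//.
apply: leeD.
  by apply: lee_wpmul2r => //; rewrite lee_fin exprS ler_piMl// exprn_ge0.
by rewrite exprSr mulrA EFinM muleAC; apply: lee_wpmul2r; rewrite ?lee_fin.
Qed.

Lemma max_copy_median n (c : R) (q := fine (P [set x | X x <= 2 * c])) :
  0 < c -> (\int[Pn n]_w (max_copy n w)%:E <= c%:E)%E -> 1 / 2 <= q ^+ n.
Proof.
move=> c0 Mc.
have c20 : 0 <= 2 * c by rewrite mulr_ge0// ltW.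
have mB := measurable_max_copy_le n (2 * c).
(* Markov in additive form: pointwise, [2 * c] is at most the maximum plus [2 * c] times the
   indicator that the maximum is at most [2 * c]. Integrating gives
   [2 * c <= c + 2 * c * q ^+ n]. *)
have : ((2 * c)%:E <= \int[Pn n]_w ((max_copy n w)%:E
   + (2 * c)%:E * (\1_[set w | max_copy n w <= 2 * c] w)%:E))%E.
  rewrite -[leLHS]mule1 -(probability_setT (Pn n)) -integral_cst//.
  apply: ge0_le_integral_nomeas => w /=; rewrite ?lee_fin//.
  rewrite indicE; case: (leP (max_copy n w) (2 * c)) => h.
    by rewrite mem_set// mulr1 lerDr max_copy_ge0.
  by rewrite memNset ?mulr0 ?addr0 ?(ltW h)//= leNgt h.
rewrite ge0_integralD//.
- rewrite ge0_integralZl_EFin//; last exact/measurable_EFinP/measurable_indic.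
  rewrite integral_max_copy_le// -EFinM => h.
  have := le_trans h (leeD2r _ Mc); rewrite -EFinD lee_fin -/q.
  move=> h'; have : c * 1 <= c * (2 * q ^+ n) by lra.
  by rewrite ler_pM2l// => h''; lra.
- by move=> w _; rewrite lee_fin max_copy_ge0.
- by apply/measurable_EFinP; exact: measurable_max_copy.
- by move=> w _; rewrite mule_ge0.
- by apply: measurable_funeM; exact/measurable_EFinP/measurable_indic.
Qed.

Lemma integral_excess_le n (c : R) : (0 < n)%N -> 0 < c ->
  (\int[Pn n]_w (max_copy n w)%:E <= c%:E)%E ->
  (\int[P]_x (excess (2 * c) (X x))%:E <= (2 * c / n%:R)%:E)%E.
Proof.
move=> n0 c0 Mc; have c20 : 0 <= 2 * c by rewrite mulr_ge0// ltW.
have q2 := max_copy_median n c c0 Mc.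
set F := (\int[P]_x _)%E.
have F0 : (0 <= F)%E.
  by apply: integral_ge0 => x _; rewrite lee_fin excess_ge0.
have n2 : 0 < n%:R / 2 :> R by rewrite divr_gt0// ltr0n.
(* The goal becomes [n / 2] times the expected excess being at most [c], where [n / 2 <= n * q ^+ n]
   by [q2]. *)
have -> : 2 * c / n%:R = (n%:R / 2)^-1 * c by rewrite invf_div mulrAC.
rewrite EFinM lee_pdivlMl//; apply: le_trans Mc.
apply: (@le_trans _ _ (\int[Pn n]_w (excess (2 * c) (max_copy n w))%:E)%E).
  apply: le_trans (integral_excess_max_copy n _ c20).
  apply: lee_wpmul2r => //; rewrite lee_fin ler_wpM2l ?ler0n//.
  by rewrite -[leLHS]mul1r.
apply: ge0_le_integral_nomeas => w; rewrite lee_fin ?excess_ge0//.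
exact/excess_le/max_copy_ge0.
Qed.

End power_max.

(** * From one candidate to the sum of the [h] largest *)

Lemma g_top_le4 (R : realType) (d : measure_display) (T : measurableType d)
    (P : probability T R) (k h : nat) (c : R) (X : 'I_k -> {RV P >-> R}) :
  (0 < k)%N -> (h %| k)%N -> 0 < c ->
  (forall i w, 0 <= X i w) -> (forall i, f_top h k (X i) <= c%:E)%E ->
  (g_top h X <= (4 * h%:R * c)%:E)%E.
Proof.
move=> k0 hk c0 X0 hf; have c20 : 0 <= 2 * c by rewrite mulr_ge0// ltW.
have h0 : (0 < h)%N by exact: dvdn_gt0 k0 hk.
have n0 : (0 < k %/ h)%N by rewrite divn_gt0// dvdn_leq.
have Xc i : (\int[P]_x (excess (2 * c) (X i x))%:E <=
             (2 * c / (k %/ h)%:R)%:E)%E.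
  by apply: integral_excess_le => //; move: (hf i); rewrite /f_top unlock.
have mX i : measurable_fun setT (fun x => (excess (2 * c) (X i x))%:E).
  by apply/measurable_EFinP; exact: measurable_excess.
have e0 x : (0 <= (excess (2 * c) x)%:E)%E by rewrite lee_fin excess_ge0.
rewrite /g_top unlock.
apply: (@le_trans _ _ (\int[P]_x ((h%:R * (2 * c))%:E
    + \sum_(i <- enum 'I_k) (excess (2 * c) (X i x))%:E))%E).
  apply: ge0_le_integral_nomeas => w.
    rewrite lee_fin; apply: sum_largest_ge0 => _ /mapP[i _ ->]; exact: X0.
  rewrite sumEFin -EFinD lee_fin (le_trans (sum_largest_le _ _ _ _ c20))//.
  by rewrite big_map.
rewrite ge0_integralD//.
- rewrite integral_cst// [X in (_ * X + _)%E]probability_setT mule1 ge0_integral_sum//.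
  apply: (@le_trans _ _ ((h%:R * (2 * c))%:E
    + \sum_(i <- enum 'I_k) (2 * c / (k %/ h)%:R)%:E)%E).
    by rewrite leeD2l//; apply: lee_sum => i _.
  rewrite sumEFin -EFinD lee_fin big_const_seq count_predT iter_addr_0.
  rewrite -[(2 * c / _) *+ _]mulr_natl size_enum_ord.
  (* Since [k = (k %/ h) * h], the [k] excess bounds add up to [h * (2 * c)], as much as the
     threshold term. *)
  rewrite -[X in X%:R * (2 * c / _)](divnK hk) natrM.
  have n0' : (k %/ h)%:R != 0 :> R by rewrite pnatr_eq0 -lt0n.
  by rewrite le_eqVlt; apply/orP; left; apply/eqP; field.
- by move=> x _; rewrite lee_fin mulr_ge0.
- by move=> x _; apply: sume_ge0 => i _.
- exact: emeasurable_sum.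
Qed.

Theorem theorem2p12 (R : realType) (d : measure_display)
    (T : measurableType d) (P : probability T R)
    (k h : nat) (hk1 : (1 <= k)%N) (hh1 : (1 <= h)%N) (hhk : (h <= k)%N)
    (hdvd : (h %| k)%N)
    (c : R) (hc : 0 <= c)
    (X : 'I_k -> {RV P >-> R})
    (hX : forall i, candidate (X i))
    (hind : mutually_independent X)
    (hf : forall i, (f_top h k (X i) <= c%:E)%E) :
  (g_top h X <=
    (2 * h%:R * c + h%:R * c / (1 - expR (- (1 / 2))))%:E)%E.
Proof.
have X0 i w : 0 <= X i w by case: (hX i).
have : (g_top h X <= (4 * h%:R * c)%:E)%E.
  (* [g_top_le4] needs a positive bound, so [c] is raised by [e / (4 * h)], which costs exactly [e]
     in the conclusion. *)
  apply/lee_addgt0Pr => e e0.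
  have h0 : 0 < 4 * h%:R :> R by rewrite mulr_gt0// ltr0n.
  have ce0 : 0 < e / (4 * h%:R) by exact: divr_gt0.
  apply: (le_trans (g_top_le4 R d T P k h (c + e / (4 * h%:R)) X hk1 hdvd _ X0 _)).
  - exact: ltr_wpDl.
  - by move=> i; rewrite (le_trans (hf i))// lee_fin lerDl ltW.
  - by rewrite -EFinD lee_fin mulrDr mulrCA divff ?mulr1// gt_eqF.
move/le_trans; apply; rewrite lee_fin.
have e1 : expR (- (1 / 2)) < 1 :> R by rewrite expR_lt1; lra.
(* From [1 + x <= expR x] at [x = - (1 / 2)]; hence [1 / (1 - expR (- (1 / 2)))] is at least [2]. *)
have e2 : 1 / 2 <= expR (- (1 / 2)) :> R.
  by apply: le_trans (expR_ge1Dx _); lra.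
have -> : 4 * h%:R * c = 2 * h%:R * c + h%:R * c * 2 by ring.
rewrite lerD2l ler_wpM2l ?mulr_ge0//.
by rewrite -[leLHS]invrK lef_pV2 ?posrE; lra.
Qed.
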